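(* Let $R,\check w,\hat w,V_{\max}$ be positive constants with $V_{\max}<\check w<\hat w$. Let $\psi\in C^2([0,R];[0,1])$ satisfy $\psi(0)=1$, $\psi(R)=0$, $\psi'(\rho)\le 0$ and $\frac{d^2}{d\rho^2}\left(\rho\,\psi(\rho)\right)\le 0$ for all $\rho\in[0,R]$. Assume that waves of the first family in the congested phase $C$ have negative speed. Consider the system $$\partial_t\rho+\partial_x\left(\rho\,v(\rho,\eta)\right)=0,\qquad \partial_t\eta+\partial_x\left(\eta\,v(\rho,\eta)\right)=0,\qquad v(\rho,\eta)=\min\left\{V_{\max},\frac{\eta}{\rho}\,\psi(\rho)\right\},$$ and fix states $(\rho^l,\eta^l)\in F$ (the free phase) and $(\rho^r,\eta^r)\in C$ (the congested phase). Then the Riemann problem for this system with initial condition $$(\rho_0,\eta_0)(x)=\begin{cases}(\rho^l,\eta^l)&\text{if }x<0,\\(\rho^r,\eta^r)&\text{if }x>0,\end{cases}$$ is solved with at most two waves.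
   Context: **Phases.** Here $\rho\in[0,R]$ is a density and $\eta=\rho w$ is a generalized momentum, with $w=\eta/\rho\in[\check w,\hat w]$. In terms of $(\rho,w)$ one has $v(\rho,\rho w)=\min\{V_{\max},w\,\psi(\rho)\}$. The free and congested phases are $$F=\{(\rho,w)\in[0,R]\times[\check w,\hat w]: v(\rho,\rho w)=V_{\max}\},\qquad C=\{(\rho,w)\in[0,R]\times[\check w,\hat w]: v(\rho,\rho w)=w\,\psi(\rho)\}.$$ These are closed sets with nonempty intersection. Writing $(\rho,\eta)\in F$ (resp. $C$) means $\eta=\rho w$ with $(\rho,w)\in F$ (resp. $C$). The ratio $\eta/\rho$ is read as $w$, also when $\rho=0$. **Characteristic fields in $C$.** The eigenvalues of the Jacobian of the flux in $C$ are $\lambda_1(\rho,\eta)=\eta\,\psi'(\rho)+v(\rho,\eta)$ and $\lambda_2(\rho,\eta)=v(\rho,\eta)$. The first Lax curve through $(\rho_o,\eta_o)$ is $\eta=\eta_o\rho/\rho_o$. The second is $\eta=\rho\,v(\rho_o,\eta_o)/\psi(\rho)$ if $\rho_o<R$, and the segment $\rho=R$, $\eta\in[R\check w,R\hat w]$ if $\rho_o=R$. The second field is linearly degenerate. **Waves.** The possible waves connecting a left state $(\rho_l,\eta_l)$ to a right state $(\rho_r,\eta_r)$ are: - a *linear wave*: both states in $F$; a jump travelling at speed $V_{\max}$; - a *phase transition wave*: left state in $F$, right state in $C$, with $\eta_l/\rho_l=\eta_r/\rho_r$; a jump whose speed is given by the Rankine–Hugoniot condition; - a *wave of the first family*: both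 states in $C$ with $\eta_l/\rho_l=\eta_r/\rho_r$; an entropy-admissible (Lax) shock or a centered rarefaction of the first characteristic field; - a *wave of the second family*: both states in $C$ with $v(\rho_l,\eta_l)=v(\rho_r,\eta_r)$; a contact discontinuity travelling at this common speed $v$. **Meaning of ''solved with at most $N$ waves''.** The Riemann problem is solved by a self-similar weak solution (a function of $x/t$) with values in $F\cup C$, consisting of constant states, the leftmost being $(\rho^l,\eta^l)$ and the rightmost $(\rho^r,\eta^r)$, separated by at most $N$ waves, each of which is a linear wave, a phase transition wave, a wave of the first family or a wave of the second family, ordered from left to right by nondecreasing speed. *)

(* Defs.v *)
From HB Require Import structures.
From mathcomp Require Import all_boot all_order all_algebra.
From mathcomp Require Import all_classical all_reals all_analysis.
Import Order.TTheory GRing.Theory Num.Theory.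
Import numFieldNormedType.Exports.

Set Implicit Arguments.
Unset Strict Implicit.
Unset Printing Implicit Defensive.

Local Open Scope classical_set_scope.
Local Open Scope ring_scope.

(* Derivatives relative to a set A: the difference quotient at x is taken along
   the points of A only, hence is one-sided at an endpoint of an interval. *)
Section RelativeDerivatives.
Variable R : realType.
Implicit Types (A : set R) (f : R -> R) (x : R).

Definition derivable_in A f x : Prop :=
  cvg ((fun y => (f y - f x) / (y - x)) @ within (A `\ x) (nbhs x)).

Definition derivative_in A f x : R :=
  lim ((fun y => (f y - f x) / (y - x)) @ within (A `\ x) (nbhs x)).

Definition C2_on A f : Prop :=
  [/\ forall x, A x -> derivable_in A f x,
      forall x, A x -> derivable_in A (derivative_in A f) x
    & {within A, continuous (derivative_in A (derivative_in A f))}].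

End RelativeDerivatives.

(* A state is given by (rho, w); the conserved momentum is eta = rho * w.  Thus
   the ratio eta / rho is w, including at the vacuum rho = 0. *)
Record state (R : realType) := State { rho : R; w : R }.

Section Model.
Variables (R : realType) (Rmax wmin wmax Vmax : R) (psi : R -> R).
Implicit Types (l m r s : state R) (sigma a b xi : R) (U P : R -> state R).

Definition eta s : R := rho s * w s.

Definition v s : R := Num.min Vmax (w s * psi (rho s)).

Definition admissible : set (state R) :=
  [set s | 0 <= rho s <= Rmax /\ wmin <= w s <= wmax].

Definition free_phase : set (state R) :=
  [set s | admissible s /\ v s = Vmax].

Definition congested_phase : set (state R) :=
  [set s | admissible s /\ v s = w s * psi (rho s)].

(* First eigenvalue of the Jacobian of the flux in the congested phase. *)
Definition lambda1 s : R := eta s * derivative_in `[0, Rmax] psi (rho s) + v s.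

Definition rankine_hugoniot l r sigma : Prop :=
  sigma * (rho r - rho l) = rho r * v r - rho l * v l /\
  sigma * (eta r - eta l) = eta r * v r - eta l * v l.

Definition linear_wave l r sigma : Prop :=
  [/\ free_phase l, free_phase r, l <> r & sigma = Vmax].

Definition phase_transition l r sigma : Prop :=
  [/\ free_phase l, congested_phase r, w l = w r, l <> r
    & rankine_hugoniot l r sigma].

Definition first_shock l r sigma : Prop :=
  [/\ congested_phase l /\ congested_phase r, w l = w r, l <> r,
      rankine_hugoniot l r sigma
    & lambda1 r <= sigma <= lambda1 l].

(* P is the profile of the fan as a function of xi = x / t. *)
Definition first_rarefaction l r P : Prop :=
  [/\ lambda1 l < lambda1 r /\ w l = w r,
      P (lambda1 l) = l /\ P (lambda1 r) = r,
      forall xi, lambda1 l <= xi <= lambda1 r ->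
        [/\ congested_phase (P xi), w (P xi) = w l & lambda1 (P xi) = xi]
    & {within `[lambda1 l, lambda1 r], continuous (fun xi => rho (P xi))}].

Definition second_contact l r sigma : Prop :=
  [/\ congested_phase l, congested_phase r, l <> r, v l = v r & sigma = v l].

(* A wave from l to r occupies the sector a <= x / t <= b; a jump has a = b, and
   then the profile P is irrelevant. *)
Definition first_family_wave l r a b P : Prop :=
  (a = b /\ first_shock l r a) \/
  [/\ a = lambda1 l, b = lambda1 r & first_rarefaction l r P].

Definition wave l r a b P : Prop :=
  [\/ a = b /\ linear_wave l r a,
      a = b /\ phase_transition l r a,
      first_family_wave l r a b P
    | a = b /\ second_contact l r a].

Definition negative_first_family : Prop :=
  forall l r a b P, first_family_wave l r a b P ->
    forall xi, a <= xi <= b -> xi < 0.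

(* wave_fan U n c l r: on the half-line xi > c, the profile U consists of
   constant states, the leftmost being l and the rightmost r, separated by at
   most n waves of nondecreasing speeds, all at least c. *)
Inductive wave_fan U : nat -> \bar R -> state R -> state R -> Prop :=
| fan_constant n c l :
    (forall xi, (c < xi%:E)%E -> U xi = l) ->
    wave_fan U n c l l
| fan_wave n c l m r a b P :
    wave l m a b P ->
    (c <= a%:E)%E ->
    (forall xi, (c < xi%:E)%E -> xi < a -> U xi = l) ->
    (forall xi, a < xi < b -> U xi = P xi) ->
    wave_fan U n b%:E m r ->
    wave_fan U n.+1 c l r.

(* C^1 functions of (t, x) with compact support in the whole plane, so that
   they need not vanish at t = 0. *)
Definition partial_t (phi : R * R -> R) (p : R * R) : R :=
  derive1 (fun t => phi (t, p.2)) p.1.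

Definition partial_x (phi : R * R -> R) (p : R * R) : R :=
  derive1 (fun x => phi (p.1, x)) p.2.

Definition test_function (phi : R * R -> R) : Prop :=
  [/\ forall p : R * R, derivable (fun t => phi (t, p.2)) p.1 1,
      forall p : R * R, derivable (fun x => phi (p.1, x)) p.2 1,
      continuous (partial_t phi),
      continuous (partial_x phi)
    & compact (closure [set p : R * R | phi p != 0])].

Definition upper_half_plane : set (R * R) := [set p | 0 < p.1].

(* Weak form of  d_t q + d_x (q v) = 0,  q(0, .) = q0,  where q is rho or eta. *)
Definition weak_balance (q : state R -> R) (u : R * R -> state R)
    (u0 : R -> state R) : Prop :=
  forall phi, test_function phi ->
    (\int[@lebesgue_measure R \x @lebesgue_measure R]_(p in upper_half_plane)
        (q (u p) * partial_t phi p + q (u p) * v (u p) * partial_x phi p)%:E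
     + \int[@lebesgue_measure R]_x (q (u0 x) * phi (0, x))%:E = 0)%E.

Definition weak_solution (u : R * R -> state R) (u0 : R -> state R) : Prop :=
  [/\ forall p, upper_half_plane p -> (free_phase `|` congested_phase) (u p),
      measurable_fun upper_half_plane (fun p => rho (u p)),
      measurable_fun upper_half_plane (fun p => eta (u p)),
      weak_balance (@rho R) u u0
    & weak_balance eta u u0].

Definition riemann_data l r (x : R) : state R := if x < 0 then l else r.

Definition riemann_solved_with_at_most (n : nat) l r : Prop :=
  exists U,
    weak_solution (fun p => U (p.2 / p.1)) (riemann_data l r) /\
    wave_fan U n -oo%E l r.

End Model.

(* Main.v *)
Require Import Defs.
From mathcomp Require Import all_boot all_order all_algebra.
From mathcomp Require Import all_classical all_reals all_analysis.
From mathcomp Require Import measurable_realfun lra ring.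
Import Order.TTheory GRing.Theory Num.Theory.
Import numFieldNormedType.Exports.
Local Open Scope classical_set_scope.
Local Open Scope ring_scope.

(** The middle state [m] is the point of the first Lax curve of [l], that is,
    with the ratio [w l], at which the velocity is already [v r]. Since
    [w l * psi] is at least [Vmax >= v r] at [rho l] and vanishes at maximal
    density, the intermediate value theorem gives such an [m] in the congested
    phase, with [rho m >= rho l]. A phase transition from [l] to [m] and a
    contact from [m] to [r] solve the problem: the Rankine-Hugoniot speed of
    the former is at most [v r], because this reduces to
    [rho l * v r <= rho l * Vmax]. Either wave disappears when the states on
    its two sides coincide.

    It remains to show that a profile with two jumps is a weak solution
    ([two_jumps_weak_solution]). Both the solution and its flux are linear
    combinations of a constant and of the indicators of two sectors
    [x < a t], and the Rankine-Hugoniot condition says that the coefficients of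
    the flux are [a] times those of the solution. By linearity the weak form
    thus reduces to the divergence theorem for the field [(phi, a phi)] on the
    sector [x < a t], [t > 0] ([balanced_sheared_domain]), and the constant is
    covered by the same identity on the whole half-plane. The
    shear [x = y + a t] makes the divergence a derivative in [t] alone, so that
    Fubini's theorem and the fundamental theorem of calculus conclude. *)

(** * Measurability of continuous functions of two real variables *)

Section PlaneMeasurability.
Context {K : realType}.

Local Notation plane := (measurableTypeR K * measurableTypeR K)%type.

(** An open set is the countable union of the squares it contains that have
    rational centres and half-sides [1 / (n + 1)]. *)
Lemma open_plane_measurable (A : set (K * K)) :
  open A -> measurable (A : set plane).
Proof.
move=> oA.
pose box (q r : rat) (n : nat) : set plane :=
  ball (ratr q : K) n.+1%:R^-1 `*` ball (ratr r : K) n.+1%:R^-1.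
have mbox q r n : measurable (box q r n).
  by apply: measurableX; apply: open_measurable; exact: ball_open.
have -> : A = \bigcup_q \bigcup_r \bigcup_n
    (if `[< box q r n `<=` A >] then box q r n else set0).
  apply/seteqP; split => [p Ap|p [q _ [r _ [n _]]]]; last first.
    by case: ifPn => [/asboolP H /H|].
  have /nbhs_ballP[e /= e0 peA] : nbhs p A by exact: open_nbhs_nbhs.
  have [n ne] : exists n : nat, n.+1%:R^-1 < e / 2 :> K.
    have /= := @near_infty_natSinv_lt K (PosNum (divr_gt0 e0 (ltr0n _ 2))).
    by case=> N _ /(_ N (leqnn _)) /= ?; exists N.
  have n0 : 0 < n.+1%:R^-1 :> K by rewrite invr_gt0.
  have dense (x : K) : exists q : rat, `|ratr q - x| < n.+1%:R^-1.
    have := @rat_in_itvoo K (x - n.+1%:R^-1) (x + n.+1%:R^-1).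
    have -> : x - n.+1%:R^-1 < x + n.+1%:R^-1.
      by rewrite ltrBlDr -addrA ltrDl addr_gt0.
    move=> /(_ isT)[q]; rewrite in_itv/= => xq; exists q.
    by rewrite ltr_distl.
  have [q pq] := dense p.1; have [r pr] := dense p.2.
  exists q => //; exists r => //; exists n => //.
  rewrite ifT; last first.
    apply/asboolP => -[x y] [/= xq yr]; apply: peA; split => /=;
      (apply: (@le_ball _ _ _ (n.+1%:R^-1 + n.+1%:R^-1));
        first by rewrite (splitr e) lerD// ltW).
      by apply: ball_triangle xq; rewrite /ball/= distrC.
    by apply: ball_triangle yr; rewrite /ball/= distrC.
  by split.
do 2 (apply: bigcupT_measurable_rat => ?).
apply: bigcupT_measurable => n; case: ifP => // _; exact: mbox.
Qed.

Lemma continuous_plane_measurable (g : K * K -> K) :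
  continuous g -> measurable_fun [set: plane] (g : plane -> K).
Proof.
move=> /continuousP cg; apply: (measurability _ (RGenOpens.measurableE K)).
move=> _ [_ [a [b ->] <-]]; rewrite setTI.
by apply: open_plane_measurable; apply: cg; exact: interval_open.
Qed.

End PlaneMeasurability.

(** * Derivative of a test function along a line *)

Section ChainRule.
Context {K : realType}.

(** The mean value theorem for an increment [h] of either sign, or zero. *)
Lemma mean_value_increment (f : K -> K) (x h : K) :
  (forall y : K, derivable f y 1) ->
  exists2 c, `|c - x| <= `|h| & f (x + h) - f x = derive1 f c * h.
Proof.
move=> df.
have cf a b : {within `[a, b], continuous f}.
  apply: continuous_subspaceT => y.
  exact/differentiable_continuous/derivable1_diffP.
have dfE (y : K) : is_derive y 1 f (derive1 f y) by rewrite derive1E; exact/derivableP.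
have [h0|h0] := leP 0 h.
  have [|c + ->] := @MVT_segment _ f (derive1 f) x (x + h) _ (fun y _ => dfE y) (cf _ _).
    by rewrite lerDl.
  rewrite in_itv/= => /andP[xc cx]; exists c; last by congr (_ * _); ring.
  by rewrite !ger0_norm; lra.
have [|c + fc] :=
  @MVT_segment _ f (derive1 f) (x + h) x _ (fun y _ => dfE y) (cf _ _); first lra.
rewrite in_itv/= => /andP[xc cx]; exists c.
  by rewrite !ler0_norm; lra.
by rewrite -opprB fc; ring.
Qed.

(** The chain rule along the line [x = y + a t] for a function whose partial
    derivatives exist and are continuous: the increment is split into one in
    [t] and one in [x], and the mean value theorem is applied to each. *)
Lemma is_derive_along_line (phi : K * K -> K) (a y t : K) :
  test_function phi ->
  is_derive t 1 (fun s => phi (s, y + a * s))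
    (partial_t phi (t, y + a * t) + a * partial_x phi (t, y + a * t)).
Proof.
move=> [dt dx ct cx _].
set X := y + a * t; set l := _ + _.
suff lim : h^-1 *: (phi (h + t, y + a * (h + t)) - phi (t, X)) @[h --> 0^'] --> l.
  apply: DeriveDef.
    apply/cvg_ex; exists l => /=.
    by under eq_fun => h do rewrite [h *: 1]mulr1.
  apply/cvg_lim => //=; by under eq_fun => h do rewrite [h *: 1]mulr1.
apply/cvgrPdist_le => e e0.
have a1 : 0 < 1 + `|a| by rewrite ltr_pwDl.
(* The two errors, weighted by 1 and `|a|, must add up to at most e. *)
pose e' := e / (1 + `|a|); have e'0 : 0 < e' by rewrite divr_gt0.
have /cvgrPdist_lt/(_ _ e'0)/nbhs_ballP[d1 /= d10 H1] := ct (t, X).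
have /cvgrPdist_lt/(_ _ e'0)/nbhs_ballP[d2 /= d20 H2] := cx (t, X).
pose d := Num.min d1 d2 / (1 + `|a|).
have d0 : 0 < d by rewrite divr_gt0// lt_min d10.
have dE : d * (1 + `|a|) = Num.min d1 d2 by rewrite /d divfK// gt_eqF.
near=> h.
have h0 : h != 0 by near: h; exact: nbhs_dnbhs_neq.
have hd : `|h| < d by near: h; exact: dnbhs0_lt.
have [tau tauh tauE] :=
  @mean_value_increment (fun s => phi (s, X + a * h)) t h (fun s => dt (s, _)).
have [xi xih xiE] :=
  @mean_value_increment (fun z => phi (t, z)) X (a * h) (fun s => dx (t, s)).
have ahd : `|a * h| < Num.min d1 d2.
  have [->|an0] := eqVneq a 0; first by rewrite mul0r normr0 lt_min d10.
  rewrite -dE normrM mulrC mulrDr mulr1 ltr_wpDl// ?(ltW d0)//.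
  by rewrite ltr_pM2r// normr_gt0.
have hd' : `|h| < Num.min d1 d2.
  by rewrite (lt_le_trans hd)// -dE ler_peMr// ?(ltW d0)// lerDl.
have B1 : `|partial_t phi (t, X) - partial_t phi (tau, X + a * h)| < e'.
  apply: H1; split => /=; rewrite /ball/=.
    by rewrite distrC (le_lt_trans tauh)// (lt_le_trans hd')// ge_min lexx.
  rewrite opprD addrA subrr sub0r normrN.
  by rewrite (lt_le_trans ahd)// ge_min lexx.
have B2 : `|partial_x phi (t, X) - partial_x phi (t, xi)| < e'.
  apply: H2; split => /=; rewrite /ball/= ?subrr ?normr0//.
  by rewrite distrC (le_lt_trans xih)// (lt_le_trans ahd)// ge_min lexx orbT.
have -> : phi (h + t, y + a * (h + t)) - phi (t, X) =
    h * (partial_t phi (tau, X + a * h) + a * partial_x phi (t, xi)).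
  transitivity ((phi (t + h, X + a * h) - phi (t, X + a * h))
      + (phi (t, X + a * h) - phi (t, X))).
    rewrite addrA subrK; congr (phi (_, _) - _); first by rewrite addrC.
    by rewrite /X; ring.
  rewrite tauE xiE /partial_t /partial_x /=; ring.
rewrite scalerA mulVf// scale1r /l.
rewrite (_ : _ - _ = (partial_t phi (t, X) - partial_t phi (tau, X + a * h))
   + a * (partial_x phi (t, X) - partial_x phi (t, xi))); last ring.
apply: (le_trans (ler_normD _ _)); rewrite normrM.
have -> : e = e' + `|a| * e' by rewrite /e'; field; rewrite gt_eqF.
by apply: lerD; [exact: ltW|apply: ler_wpM2l => //; exact: ltW].
Unshelve. all: by end_near. Qed.

End ChainRule.

(** * Integrability of compactly supported functions *)

Section CompactSupport.
Context {K : realType}.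

Local Notation mu := (@lebesgue_measure K).
Local Notation plane := (measurableTypeR K * measurableTypeR K)%type.

(** [g] vanishes outside the square of half-side [M] centred at the origin. *)
Definition supported_in_square (M : K) (g : K * K -> K) : Prop :=
  forall p, M < `|p.1| \/ M < `|p.2| -> g p = 0.

Lemma test_function_supported (phi : K * K -> K) : test_function phi ->
  exists2 M, 0 < M & [/\ supported_in_square M phi,
    supported_in_square M (partial_t phi)
    & supported_in_square M (partial_x phi)].
Proof.
move=> [_ _ _ _ cK].
have [M0 [_ HM]] := compact_bounded cK.
pose M := `|M0| + 1.
have phi0 : supported_in_square M phi.
  move=> p pM; apply/eqP/negPn/negP => phip.
  have /(HM M) : M0 < M by rewrite (le_lt_trans (ler_norm _))// ltrDl.
  move=> /(_ p (subset_closure (phip : [set q | phi q != 0] p))) /=.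
  rewrite prod_normE ge_max => /andP[p1 p2].
  by case: pM; rewrite ltNge ?p1 ?p2.
have faraway (f : K -> K) z : M < `|z| ->
    (forall s, M < `|s| -> f s = 0) -> derive1 f z = 0.
  move=> zM f0; rewrite derive1E -(@derive_cst _ _ _ (0 : K) z 1).
  apply: near_eq_derive; near=> s; apply: f0; near: s.
  exact: (cvgr_gt _ (@norm_continuous _ K z)).
have zero (f : K -> K) z : (forall s, f s = 0) -> derive1 f z = 0.
  by move=> f0; rewrite (_ : f = cst 0) ?derive1_cst//; exact/funext.
exists M; first by rewrite ltr_wpDl.
split=> // -[t x] /= [tM|xM]; rewrite /partial_t /partial_x /=.
- by apply: faraway => // s sM; apply: phi0; left.
- by apply: zero => s; apply: phi0; right.
- by apply: zero => s; apply: phi0; left.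
- by apply: faraway => // s sM; apply: phi0; right.
Unshelve. all: by end_near. Qed.

Lemma continuous_supported_integrable (M : K) (g : K * K -> K) :
  continuous g -> supported_in_square M g ->
  (mu \x mu)%E.-integrable [set: plane] (EFin \o (g : plane -> K)).
Proof.
move=> cg g0.
pose sq : set plane := `[- M, M]%classic `*` `[- M, M]%classic.
have msq : measurable sq by apply: measurableX; exact: measurable_itv.
have csq : compact (sq : set (K * K)).
  by apply: compact_setX; exact: segment_compact.
have sqoo : ((mu \x mu)%E sq < +oo)%E.
  have Ioo : (mu (`[- M, M]%classic : set K)%R < +oo)%E.
    by rewrite lebesgue_measure_itv/=; case: ifP => _; rewrite ?ltry// -EFinB ltry.
  rewrite product_measure1E; [|exact: measurable_itv|exact: measurable_itv].
  by apply: lte_mul_pinfty => //; rewrite ge0_fin_numE.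
have -> : EFin \o (g : plane -> K) = (EFin \o (g : plane -> K)) \_ sq.
  apply/funext => -[t x]; rewrite patchE; case: ifPn => //= /negP tx.
  congr EFin; apply: g0 => /=; apply/orP/negPn/negP.
  rewrite negb_or -!leNgt => /andP[tM xM]; apply: tx; rewrite inE.
  by split; rewrite /= in_itv/= -ler_norml.
apply/(integrable_mkcond _ msq)/measurable_bounded_integrable => //.
- by apply: measurable_funTS; exact: continuous_plane_measurable.
- have /compact_bounded[N [Nr HN]] : compact (g @` (sq : set (K * K))).
    apply: continuous_compact => //; exact: continuous_subspaceT.
  by exists N; split => // x Nx p sp; apply: (HN x Nx); exists p.
Qed.

Lemma continuous_comp_pair (T : topologicalType) (f1 f2 : T -> K)
    (g : K * K -> K) :
  continuous f1 -> continuous f2 -> continuous g ->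
  continuous (fun z => g (f1 z, f2 z)).
Proof.
move=> c1 c2 cg z.
apply: (@continuous2_cvg _ _ _ _ (nbhs z) _ f1 f2 (fun a b => g (a, b))).
- rewrite (_ : (fun _ : K * K => _) = g); first exact: cg.
  by apply/funext => -[].
- exact: c1.
- exact: c2.
Qed.

Lemma continuous_supported_integrable1 (M : K) (f : K -> K) :
  continuous f -> (forall x, M < `|x| -> f x = 0) ->
  mu.-integrable setT (EFin \o (f : measurableTypeR K -> K)).
Proof.
move=> cf f0.
pose I : set (measurableTypeR K) := `[- M, M]%classic.
have mI : measurable I by exact: measurable_itv.
have -> : EFin \o (f : measurableTypeR K -> K) = (EFin \o f) \_ I.
  apply/funext => x; rewrite patchE; case: ifPn => //= /negP xI.
  congr EFin; apply: f0; rewrite ltNge; apply/negP => xM.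
  by apply: xI; rewrite inE /I/= in_itv/= -ler_norml.
apply/(integrable_mkcond _ mI); apply: continuous_compact_integrable.
  exact: segment_compact.
exact: continuous_subspaceT.
Qed.

End CompactSupport.

(** * Translation invariance of the Lebesgue measure *)

Section Translation.
Context {K : realType}.
Local Notation mu := (@lebesgue_measure K).

Lemma lebesgue_measure_translation (c : K) (A : set (measurableTypeR K)) :
  measurable A -> mu A = pushforward mu (fun x : measurableTypeR K => x + c) A.
Proof.
have mT : measurable_fun setT ((fun x => x + c) : measurableTypeR K -> measurableTypeR K).
  exact: measurable_funD.
pose T : {mfun measurableTypeR K >-> measurableTypeR K} :=
  MeasurableFun.Pack (MeasurableFun.Class (isMeasurableFun.Build _ _ _ _ _ mT)).
move=> mA.
apply: (@lebesgue_measure_unique K (pushforward mu T)) => // X [[a b] _ <-] /=.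
rewrite /pushforward.
have -> : (fun x => x + c) @^-1` `]a, b]%classic = `]a - c, b - c]%classic.
  by apply/seteqP; split => x /=; rewrite !in_itv/= ltrBlDr lerBrDr.
rewrite !lebesgue_measure_itv/= !lte_fin ltrD2r; case: ifP => // _.
by rewrite -!EFinB; congr EFin; ring.
Qed.

(** No integrability is needed: the positive and negative parts are treated
    separately. *)
Lemma integral_translation (c : K) (f : measurableTypeR K -> \bar K) :
  measurable_fun [set: measurableTypeR K] f ->
  (\int[mu]_x f x = \int[mu]_x f (x + c)%R)%E.
Proof.
move=> mf.
have mT : measurable_fun setT ((fun x => x + c) : measurableTypeR K -> measurableTypeR K).
  exact: measurable_funD.
pose T : {mfun measurableTypeR K >-> measurableTypeR K} :=
  MeasurableFun.Pack (MeasurableFun.Class (isMeasurableFun.Build _ _ _ _ _ mT)).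
have ge0 (g : measurableTypeR K -> \bar K) : measurable_fun setT g ->
    (forall x, 0 <= g x)%E -> (\int[mu]_x g x = \int[mu]_x g (x + c)%R)%E.
  move=> mg g0; rewrite (@eq_measure_integral _ _ _ _ (pushforward mu T)).
    by rewrite ge0_integral_pushforward.
  by move=> A mA _; exact: lebesgue_measure_translation.
rewrite integralE [RHS]integralE; congr (_ - _)%E.
- have E := ge0 _ (measurable_funepos mf) (funepos_ge0 f).
  etransitivity; first exact: E.
  by apply: eq_integral => x _; rewrite !funeposE.
- have E := ge0 _ (measurable_funeneg mf) (funeneg_ge0 f).
  etransitivity; first exact: E.
  by apply: eq_integral => x _; rewrite !funenegE.
Qed.

End Translation.

(** * The divergence theorem on sheared domains *)

Section SectorIdentity.
Context {K : realType}.

Local Notation mu := (@lebesgue_measure K).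
Local Notation plane := (measurableTypeR K * measurableTypeR K)%type.
Local Notation upper := (@upper_half_plane K : set plane).

Lemma measurable_upper_half_plane : measurable upper.
Proof.
have -> : upper = `]0%R, +oo[%classic `*` setT.
  apply/seteqP; split => p; rewrite /upper_half_plane/= in_itv/= andbT => //.
  by case.
by apply: measurableX => //; exact: measurable_itv.
Qed.

Lemma fundamental_theorem_half_line (F f : K -> K) (M : K) : 0 < M ->
  (forall t : K, is_derive t 1 F (f t)) -> continuous f ->
  (forall t, M < t -> f t = 0) -> F M = 0 ->
  (\int[mu]_(t in `]0%R, +oo[) (f t)%:E = (- F 0)%:E)%E.
Proof.
move=> M0 dF cf f0 FM.
have cF : continuous F.
  by move=> t; apply/differentiable_continuous/derivable1_diffP; case: (dF t).
have -> : (\int[mu]_(t in `]0%R, +oo[) (f t)%:E =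
           \int[mu]_(t in `]0%R, M]) (f t)%:E)%E.
  rewrite integral_mkcond [RHS]integral_mkcond; apply: eq_integral => t _.
  rewrite !patchE; have [tM|Mt] := leP t M.
    by rewrite !mem_setE !in_itv/= tM andbT.
  by rewrite f0// !if_same.
rewrite integral_itv_obnd_cbnd; last first.
  by apply/measurable_EFinP/measurable_funTS; exact: continuous_measurable_fun.
rewrite (@continuous_FTC2 _ f F)// -?EFinB ?FM ?sub0r//.
- by apply: continuous_subspaceT.
- split; first by move=> t _; case: (dF t).
  + by apply: cvg_at_right_filter; exact: cF.
  + by apply: cvg_at_left_filter; exact: cF.
- by move=> t _; rewrite derive1E; case: (dF t).
Qed.

(** The integral of [F] over the open half-plane [t > 0] and that of [f0] over
    the line [t = 0] exist and cancel. The weak form of a balance law with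
    given initial datum asserts this cancellation for each test function. *)
Definition balanced (F : K * K -> K) (f0 : K -> K) : Prop :=
  [/\ (mu \x mu)%E.-integrable upper (EFin \o (F : plane -> K)),
      mu.-integrable setT (EFin \o (f0 : measurableTypeR K -> K))
    & (\int[mu \x mu]_(p in upper) (F p)%:E + \int[mu]_x (f0 x)%:E = 0)%E].

Lemma balancedD F G f0 g0 : balanced F f0 -> balanced G g0 ->
  balanced (fun p => F p + G p) (fun x => f0 x + g0 x).
Proof.
have mU := measurable_upper_half_plane.
move=> [iF if0 F0] [iG ig0 G0]; split.
- exact: (integrableD mU iF iG).
- exact: (integrableD measurableT if0 ig0).
- under eq_integral do rewrite EFinD.
  under [X in (_ + X)%E]eq_integral do rewrite EFinD.
  rewrite (integralD mU iF iG) (integralD measurableT if0 ig0).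
  by rewrite addeACA F0 G0 adde0.
Qed.

Lemma balancedZ c F f0 : balanced F f0 ->
  balanced (fun p => c * F p) (fun x => c * f0 x).
Proof.
have mU := measurable_upper_half_plane.
move=> [iF if0 F0]; split.
- exact: (integrableZl mU c iF).
- exact: (integrableZl measurableT c if0).
- under eq_integral do rewrite EFinM.
  under [X in (_ + X)%E]eq_integral do rewrite EFinM.
  rewrite (integralZl mU iF) (integralZl measurableT if0).
  rewrite -muleDr ?F0 ?mule0//.
  by apply: fin_num_adde_defr; exact: (integrable_fin_num mU).
Qed.

Lemma continuous_shear (a : K) (g : K * K -> K) : continuous g ->
  continuous (fun p => g (p.1, p.2 + a * p.1)).
Proof.
move=> cg; apply: continuous_comp_pair => // p; first exact: cvg_fst.
by apply: cvgD; [exact: cvg_snd|apply: cvgM; [exact: cvg_cst|exact: cvg_fst]].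
Qed.

(** The divergence theorem in the region [x - a t \in D], [t > 0], for the
    field [(phi, a phi)], whose divergence is the derivative of [phi] along the
    lines [x - a t = y]. The shear [x = y + a t] straightens the region into
    the product of a half-line and [D]. *)
Lemma balanced_sheared_domain (phi : K * K -> K) (a : K)
    (D : set (measurableTypeR K)) :
  test_function phi -> measurable D ->
  balanced
    (fun p => \1_D (p.2 - a * p.1) * (partial_t phi p + a * partial_x phi p))
    (fun x => \1_D x * phi (0, x)).
Proof.
move=> tphi mD.
have [M M0 [sphi st sx]] := test_function_supported _ tphi.
have mU := measurable_upper_half_plane.
pose g p := partial_t phi p + a * partial_x phi p.
have cg : continuous g.
  case: tphi => _ _ ct cx _ p; apply: cvgD; first exact: ct.
  by apply: cvgM; [exact: cvg_cst|exact: cx].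
have sg : supported_in_square M g.
  by move=> p pM; rewrite /g st// sx// mulr0 addr0.
pose h (p : K * K) := g (p.1, p.2 + a * p.1).
have ch : continuous h by exact: continuous_shear.
(* A square that contains the support after the shear; the term 1 puts the
   line t = M' strictly outside the support of phi. *)
pose M' := M + (`|a| * M + 1).
have MM' : M < M' by rewrite ltrDl ltr_wpDl// mulr_ge0// ltW.
have M'0 : 0 < M' by exact: lt_trans M0 MM'.
have sheared_support t y : M' < `|t| \/ M' < `|y| ->
    M < `|t| \/ M < `|y + a * t|.
  have [tM|] := leP `|t| M; last by left.
  case=> [|yM']; first by rewrite ltNge (le_trans tM)// ltW.
  right; rewrite -(ltrD2r (`|a| * M)); apply: lt_le_trans (_ : `|y| <= _).
    by rewrite (le_lt_trans _ yM')// lerD2l lerDl.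
  rewrite -{1}(addrK (a * t) y) (le_trans (ler_normB _ _))// lerD2l normrM.
  exact: ler_wpM2l.
have sh : supported_in_square M' h.
  by move=> [t y] /= /sheared_support p; apply: sg.
pose S : set plane := [set p | D (p.2 - a * p.1)].
have mS : measurable S.
  have mf : measurable_fun [set: plane] (fun p : plane => p.2 - a * p.1).
    by apply: measurable_funB => //; apply: measurable_funM.
  by rewrite -[S]setTI; exact: mf.
have mUS : measurable (upper `&` S) by exact: measurableI.
pose G : plane -> \bar K := (EFin \o g) \_ (upper `&` S).
pose S' : set plane := `]0%R, +oo[%classic `*` D.
have mS' : measurable S' by apply: measurableX => //; exact: measurable_itv.
pose H : plane -> \bar K := (EFin \o h) \_ S'.
have iG : (mu \x mu)%E.-integrable setT G.
  apply/(integrable_mkcond _ mUS).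
  by apply: (integrableS measurableT _ _ (continuous_supported_integrable _ _ cg sg)).
have iH : (mu \x mu)%E.-integrable setT H.
  apply/(integrable_mkcond _ mS').
  by apply: (integrableS measurableT _ _ (continuous_supported_integrable _ _ ch sh)).
have GE : (fun p => (\1_D (p.2 - a * p.1) * g p)%:E) \_ upper = G.
  apply/funext => p; rewrite /G /patch in_setI; case: ifP => //= _.
  rewrite /indic; have -> : (p \in S) = (p.2 - a * p.1 \in D) by [].
  by case: ifP => _; rewrite ?mul1r ?mul0r.
have iphi0 : mu.-integrable setT (EFin \o (fun x => phi (0, x))).
  apply: (continuous_supported_integrable1 M) => [x|x xM].
    apply/differentiable_continuous/derivable1_diffP.
    by case: tphi => _ dx _ _ _; exact: (dx (0, x)).
  by apply: sphi; right.
have i0 : mu.-integrable setT (EFin \o (fun x => \1_D x * phi (0, x))).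
  have -> : EFin \o (fun x => \1_D x * phi (0, x)) =
      (EFin \o (fun x => phi (0, x))) \_ D.
    apply/funext => x; rewrite /patch /indic /=.
    by case: ifP => _; rewrite ?mul1r ?mul0r.
  by apply/(integrable_mkcond _ mD); apply: (integrableS measurableT _ _ iphi0).
split => //.
  by apply/(integrable_mkcond _ mU); move: iG; rewrite -GE.
rewrite integral_mkcond GE.
have GH t y : G (t, y + a * t) = H (t, y).
  rewrite /G /H /patch /h /=; congr (if _ then _ else _).
  apply/idP/idP => /set_mem[].
    rewrite /S /= addrK => t0 Dy; apply/mem_set; split => //=.
    by rewrite in_itv/= andbT.
  rewrite /= in_itv/= andbT => t0 Dy; apply/mem_set; split => //.
  by rewrite /S /= addrK.
have -> : (\int[mu \x mu]_p G p = \int[mu]_t \int[mu]_y G (t, y))%E.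
  by rewrite -integral12_prod_meas1.
have -> : (\int[mu]_t \int[mu]_y G (t, y) = \int[mu]_t \int[mu]_y H (t, y))%E.
  apply: eq_integral => t _; rewrite (integral_translation (a * t)).
    by apply: eq_integral => y _; rewrite GH.
  by apply: measurableT_comp => //; case/integrableP: iG.
rewrite (Fubini iH).
have inner y : (\int[mu]_t H (t, y) = (- (\1_D y * phi (0, y)))%:E)%E.
  transitivity (\int[mu]_(t in `]0%R, +oo[) (\1_D y * h (t, y))%:E)%E.
    rewrite [RHS]integral_mkcond; apply: eq_integral => t _.
    rewrite /H /patch /S' in_setX /indic /=; case: ifP => /=.
      by move=> /andP[-> ->]; rewrite mul1r.
    by case: (t \in _) => //= ->; rewrite mul0r.
  pose F t := \1_D y * phi (t, y + a * t).
  have dF (t : K) : is_derive t 1 F (\1_D y * h (t, y)).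
    by apply: is_deriveZ; exact: is_derive_along_line.
  rewrite (fundamental_theorem_half_line F _ M' M'0 dF).
  - by rewrite /F mulr0 addr0.
  - move=> t; apply: cvgM; first exact: cvg_cst.
    apply: (continuous_comp_pair _ (fun s : K => s) (fun=> y)) => // z.
      exact: cvg_id.
    exact: cvg_cst.
  - move=> t Mt; rewrite sh ?mulr0//; left => /=.
    by rewrite gtr0_norm// (lt_trans M'0).
  - by rewrite /F sphi ?mulr0//; left; rewrite gtr0_norm.
under eq_integral do rewrite inner.
under eq_integral do rewrite -mulN1r EFinM.
rewrite (integralZl measurableT i0) EFinN mulN1e addeC subee//.
exact: (integrable_fin_num measurableT).
Qed.

End SectorIdentity.

(** * Piecewise constant self-similar solutions *)

Section TwoJumps.
Context {K : realType}.
Variables (R wmin wmax Vmax : K) (psi : K -> K).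

Local Notation plane := (measurableTypeR K * measurableTypeR K)%type.
Local Notation negatives := (`]-oo, 0%R[%classic : set (measurableTypeR K)).

(** The self-similar profile, as a function of [xi = x / t], with the values
    [l], [m], [r] separated by jumps at [a] and [b]. *)
Definition two_jumps (l m r : state K) (a b xi : K) : state K :=
  if xi < a then l else if xi < b then m else r.

Lemma two_jumps_indicators (T : state K -> K) l m r a b (p : K * K) :
  a <= b -> 0 < p.1 ->
  T (two_jumps l m r a b (p.2 / p.1)) =
  T r + (T l - T m) * \1_negatives (p.2 - a * p.1)
      + (T m - T r) * \1_negatives (p.2 - b * p.1).
Proof.
move=> ab p0.
have ind c : \1_negatives (p.2 - c * p.1) = (p.2 / p.1 < c)%R%:R :> K.
  by rewrite indicE mem_setE in_itv/= subr_lt0 ltr_pdivrMr.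
rewrite /two_jumps !ind; case: (ltP _ a) => [xa|ax].
  by rewrite (lt_le_trans xa ab) !mulr1; ring.
by case: ltP => _; rewrite ?mulr1 ?mulr0; ring.
Qed.

Lemma two_jumps_measurable (T : state K -> K) l m r a b : a <= b ->
  measurable_fun (upper_half_plane (R:=K) : set plane)
    (fun p => T (two_jumps l m r a b (p.2 / p.1))).
Proof.
move=> ab.
have mind c : measurable_fun [set: plane]
    (fun p : plane => \1_negatives (p.2 - c * p.1) : K).
  apply: (measurableT_comp (measurable_indic (measurable_itv _))).
  by apply: measurable_funB => //; exact: measurable_funM.
pose f (p : plane) := T r + (T l - T m) * \1_negatives (p.2 - a * p.1)
      + (T m - T r) * \1_negatives (p.2 - b * p.1).
apply: (@eq_measurable_fun _ _ _ _ _ f) => [p|].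
  by rewrite inE => p0; rewrite two_jumps_indicators.
apply: measurable_funTS; apply: measurable_funD; last exact: measurable_funM.
by apply: measurable_funD => //; exact: measurable_funM.
Qed.

Lemma two_jumps_weak_balance (q : state K -> K) l m r a b : a <= b ->
  a * (q m - q l) = q m * v Vmax psi m - q l * v Vmax psi l ->
  b * (q r - q m) = q r * v Vmax psi r - q m * v Vmax psi m ->
  weak_balance Vmax psi q (fun p => two_jumps l m r a b (p.2 / p.1))
    (riemann_data l r).
Proof.
move=> ab jump_a jump_b phi tphi.
have mN : measurable negatives by exact: measurable_itv.
have B D c := balanced_sheared_domain phi c D tphi.
pose f s := q s * v Vmax psi s.
(* The constant part of the integrand is q r * phi_t + f r * phi_x, which is
   (q r - f r) * phi_t + f r * (phi_t + phi_x): the speeds 0 and 1 on the whole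
   half-plane. *)
have [_ _] := balancedD _ _ _ _
  (balancedD _ _ _ _ (balancedZ (q r - f r) _ _ (B _ 0 measurableT))
                     (balancedZ (f r) _ _ (B _ 1 measurableT)))
  (balancedD _ _ _ _ (balancedZ (q l - q m) _ _ (B _ a mN))
                     (balancedZ (q m - q r) _ _ (B _ b mN))).
move=> <-; congr (_ + _)%E; last first.
  apply: eq_integral => /= x _; congr EFin.
  rewrite !indicE in_setT mem_setE in_itv/= /riemann_data.
  by case: ifP => _; rewrite ?mul1r ?mul0r; ring.
apply: eq_integral => /= p.
rewrite inE => p0; congr EFin.
rewrite -[q _ * v _ _ _]/(f _) (two_jumps_indicators f)//.
rewrite (two_jumps_indicators q)//.
rewrite !indicE !in_setT.
have fm : f l - f m = a * (q l - q m).
  by rewrite -opprB -jump_a -mulrN opprB.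
have fr : f m - f r = b * (q m - q r).
  by rewrite -opprB -jump_b -mulrN opprB.
rewrite fm fr (_ : true%:R = 1 :> K)//.
by move: (_%:R : K) (_%:R : K) => ? ?; ring.
Qed.

(** Each of the two jumps may be trivial ([l = m] or [m = r]), in which case the
    Rankine-Hugoniot condition imposes nothing on its speed. *)
Lemma two_jumps_weak_solution l m r a b : a <= b ->
  rankine_hugoniot Vmax psi l m a -> rankine_hugoniot Vmax psi m r b ->
  let FC := free_phase R wmin wmax Vmax psi
            `|` congested_phase R wmin wmax Vmax psi in
  FC l -> FC m -> FC r ->
  weak_solution R wmin wmax Vmax psi
    (fun p => two_jumps l m r a b (p.2 / p.1)) (riemann_data l r).
Proof.
move=> ab [rho_a eta_a] [rho_b eta_b] FC Fl Fm Fr; split.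
- by move=> p _; rewrite /two_jumps; case: ifP => // _; case: ifP.
- exact: two_jumps_measurable.
- exact: two_jumps_measurable.
- exact: two_jumps_weak_balance.
- exact: two_jumps_weak_balance.
Qed.

End TwoJumps.

(** * Continuity and the intermediate state *)

Lemma derivable_in_within_continuous {K : realType} (A : set K) (f : K -> K) :
  (forall x, A x -> derivable_in A f x) -> {within A, continuous f}.
Proof.
move=> df.
suff fx (x : K) : A x -> f @ within A (nbhs x) --> f x.
  by apply/subspace_continuousP => x; exact: fx.
move=> Ax.
have xx : (y - x) @[y --> within (A `\ x) (nbhs x)] --> (0 : K).
  rewrite -(subrr x); apply: cvg_within_filter.
  by apply: (@cvgB _ _ _ (nbhs x)); [exact: cvg_id|exact: cvg_cst].
(* The increment is the difference quotient times y - x. *)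
have incr : ((f y - f x) / (y - x) * (y - x))
    @[y --> within (A `\ x) (nbhs x)] --> (0 : K).
  by rewrite -(mulr0 (derivative_in A f x)); apply: cvgM xx; exact: df.
apply/cvgrPdist_lt => e e0.
have /cvgrPdist_lt/(_ _ e0) := incr.
rewrite !near_withinE; apply: filterS => y Hy Ay.
have [->|yx] := eqVneq y x; first by rewrite subrr normr0.
have /Hy : (A `\ x) y by split => //; exact/eqP.
by rewrite sub0r normrN /= divfK ?subr_eq0// distrC.
Qed.

Theorem proposition3p1 (K : realType) (R wmin wmax Vmax : K) (psi : K -> K)
  (R_gt0 : 0 < R) (wmin_gt0 : 0 < wmin) (wmax_gt0 : 0 < wmax)
  (Vmax_gt0 : 0 < Vmax) (Vmax_lt : Vmax < wmin) (wmin_lt : wmin < wmax)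
  (psi_C2 : C2_on `[0, R] psi)
  (psi_range : forall x, 0 <= x <= R -> 0 <= psi x <= 1)
  (psi0 : psi 0 = 1) (psiR : psi R = 0)
  (psi_decr : forall x, 0 <= x <= R -> derivative_in `[0, R] psi x <= 0)
  (flow_concave : forall x, 0 <= x <= R ->
     derivative_in `[0, R] (derivative_in `[0, R] (fun y => y * psi y)) x <= 0)
  (first_neg : negative_first_family R wmin wmax Vmax psi)
  (l r : state K)
  (l_free : free_phase R wmin wmax Vmax psi l)
  (r_cong : congested_phase R wmin wmax Vmax psi r) :
  riemann_solved_with_at_most R wmin wmax Vmax psi 2 l r.
Proof.
set vr := v Vmax psi r.
have [[/andP[rl0 rlR] wl] vl] := l_free.
have [[rrR wr] vrE] := r_cong.
have vr0 : 0 <= vr.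
  rewrite /vr vrE mulr_ge0//.
    by case/andP: wr => wr _; exact: le_trans (ltW wmin_gt0) wr.
  by case/andP: (psi_range _ rrR).
have vrV : vr <= Vmax by rewrite /vr /v ge_min lexx.
have lV : Vmax <= w l * psi (rho l) by rewrite -vl /v ge_min lexx orbT.
(* The middle state keeps the ratio w of l and already has the velocity of r. *)
have [x + xE] : exists2 x, x \in `[rho l, R] & w l * psi x = vr.
  apply: IVT => //; last first.
    rewrite psiR mulr0; have := le_trans vrV lV => vrl.
    by rewrite ge_min vr0 orbT le_max vrl.
  have cpsi : {within `[0, R], continuous psi}.
    by apply: derivable_in_within_continuous; case: psi_C2.
  have clR : {within `[rho l, R], continuous psi}.
    by apply: continuous_subspaceW cpsi; apply: subset_itvr; rewrite bnd_simp.
  by move=> y; apply: cvgM; [exact: cvg_cst|exact: clR].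
rewrite in_itv/= => /andP[lx xR].
pose m : state K := State x (w l).
have vm : v Vmax psi m = vr by rewrite /v /= xE; exact/min_idPr.
have m_cong : congested_phase R wmin wmax Vmax psi m.
  by split; [split=> //=; rewrite (le_trans rl0 lx)|rewrite vm -xE].
have jump_mr : rankine_hugoniot Vmax psi m r vr.
  by split; rewrite vm -/vr; ring.
have FCl : (free_phase R wmin wmax Vmax psi
            `|` congested_phase R wmin wmax Vmax psi) l by left.
(* The part of the fan to the right of m: one contact, or none if m = r. *)
have contact U n c : (c <= vr%:E)%E ->
    (forall xi, (c < xi%:E)%E -> xi < vr -> U xi = m) ->
    (forall xi, vr <= xi -> U xi = r) ->
    wave_fan R wmin wmax Vmax psi U n.+1 c m r.
  move=> cvr Um Ur.
  have [mr|mr] := pselect (m = r).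
    rewrite mr in Um *; apply: fan_constant => xi cxi.
    by have [|] := ltP xi vr; [exact: Um|exact: Ur].
  apply: (@fan_wave _ _ _ _ _ _ _ _ _ _ r _ vr vr U) => //.
  - by apply: Or44; split => //; split.
  - by apply: fan_constant => xi; rewrite lte_fin => /ltW; exact: Ur.
(* If rho m = rho l, then l is itself the middle state. *)
have [lm|lm] := eqVneq (rho l) x.
  have lE : l = m by rewrite /m -lm; case: (l).
  exists (two_jumps l m r vr vr); split.
    apply: two_jumps_weak_solution => //; [|by right|by right].
    by rewrite lE; split; rewrite !subrr mulr0.
  rewrite [in X in wave_fan _ _ _ _ _ _ _ _ X]lE.
  apply: contact => [|xi _ xivr|xi vrxi]; rewrite ?leNye// /two_jumps.
    by rewrite xivr.
  by rewrite ltNge vrxi.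
have {}lx : rho l < x by rewrite lt_neqAle lm.
(* The speed given by the Rankine-Hugoniot condition for rho; since w is the
   same on both sides, the condition for eta follows. *)
pose a := (x * vr - rho l * Vmax) / (x - rho l).
have aE : a * (x - rho l) = x * vr - rho l * Vmax.
  by rewrite divfK// subr_eq0 gt_eqF.
have jump_lm : rankine_hugoniot Vmax psi l m a.
  split; rewrite vm vl /eta /=; first exact: aE.
  rewrite -mulrBl mulrA aE; ring.
have avr : a <= vr.
  rewrite ler_pdivrMr ?subr_gt0// mulrBr (mulrC x) lerB//.
  by rewrite mulrC ler_wpM2l.
exists (two_jumps l m r a vr); split.
  by apply: two_jumps_weak_solution => //; [right|right].
apply: (@fan_wave _ _ _ _ _ _ _ _ _ _ m _ a a (two_jumps l m r a vr)).
- apply: Or42; split => //; split => //; first by move=> lE; rewrite lE /= eqxx in lm.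
- by rewrite leNye.
- by move=> xi _ xia; rewrite /two_jumps xia.
- by [].
- apply: contact => // xi.
  + by rewrite lte_fin /two_jumps => axi ->; rewrite ltNge (ltW axi).
  + move=> vrxi; rewrite /two_jumps ltNge (le_trans avr vrxi) /=.
    by rewrite ltNge vrxi.
Qed.
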